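(* Let $n\ge 2$. (1) Let $m\ge 2$ and $F=\sum_{l=0}^m f^{(l)}\in\mathbf{S}^m$. Then $J^{m,k}F(x,\xi)=0$ for all $(x,\xi)\in\mathbb{R}^n\times\mathbb{S}^{n-1}$ and all $k=0,1,\dots,m$ if and only if both $$f^{(2[\frac m2])}=-i_\delta\left(\sum_{l=1}^{[\frac m2]} i_\delta^{[\frac m2]-l} f^{(2l-2)}\right)\quad\text{and}\quad f^{(2[\frac{m-1}2]+1)}=-i_\delta\left(\sum_{l=1}^{[\frac{m-1}2]} i_\delta^{[\frac{m-1}2]-l} f^{(2l-1)}\right).$$ (2) Moreover, for $m\in\{0,1\}$ and $F\in\mathbf{S}^m$, $J^{m,k}F=0$ for all $k=0,\dots,m$ if and only if $F=0$.
   Context: Repeated indices are summed from $1$ to $n$. $S^p$ is the space of smooth compactly supported symmetric $p$-tensor fields on $\mathbb{R}^n$ and $\mathbf{S}^m=S^0\oplus S^1\oplus\cdots\oplus S^m$; $F\in\mathbf{S}^m$ is written $F=\sum_{l=0}^m f^{(l)}$ with $f^{(l)}\in S^l$. For an integer $k\ge0$ and $(x,\xi)\in\mathbb{R}^n\times\mathbb{S}^{n-1}$, $$J^{m,k}F(x,\xi)=\sum_{l=0}^m\int_{-\infty}^\infty t^k f^{(l)}_{i_1\cdots i_l}(x+t\xi)\,\xi^{i_1}\cdots\xi^{i_l}\,dt.$$ The operator $i_\delta:S^p\to S^{p+2}$ is $(i_\delta f)_{i_1\cdots i_{p+2}}=\sigma(i_1\dots i_{p+2})\,f_{i_1\dots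 i_p}\delta_{i_{p+1}i_{p+2}}$, with $\delta$ the Kronecker delta and $\sigma$ symmetrization (average over all permutations); $i_\delta^q$ is its $q$-fold composition ($i_\delta^0$ the identity). $[\cdot]$ is the integer part, and empty sums are $0$. *)

(* Defs.v *)
From mathcomp Require Import all_boot all_order all_algebra.
From mathcomp Require Import perm.
From mathcomp Require Import all_classical all_reals all_analysis.

Set Implicit Arguments.
Unset Strict Implicit.
Unset Printing Implicit Defensive.

Import Order.TTheory GRing.Theory Num.Theory.
Import numFieldNormedType.Exports.
Local Open Scope classical_set_scope.
Local Open Scope ring_scope.

(* The component of multi-index [:: i_1; ...; i_p] is a function on R^n. An    *)
(* inhabitant carries components of every rank, so it is an element of the     *)
(* product over p of the rank-p tensor fields; a rank-p field is embedded as a *)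
(* family vanishing on multi-indices of length other than p.                   *)
Definition tensor_field (R : realType) (n : nat) : Type :=
  seq 'I_n -> 'rV[R]_n -> R.

(* f^(l), extended by 0 in the other ranks *)
Definition part (R : realType) (n l : nat) (F : tensor_field R n) :
    tensor_field R n :=
  fun I => if size I == l then F I else 0.

Fixpoint partials (R : realType) (n : nat) (s : seq 'I_n)
    (g : 'rV[R]_n -> R) : 'rV[R]_n -> R :=
  if s is i :: s' then fun x => 'D_(delta_mx 0 i) (partials s' g) x else g.

Definition smooth (R : realType) (n : nat) (g : 'rV[R]_n -> R) : Prop :=
  forall s : seq 'I_n,
    continuous (partials s g) /\
    forall (i : 'I_n) (x : 'rV[R]_n),
      derivable (partials s g) x (delta_mx 0 i).

Definition compactly_supported (R : realType) (n : nat)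
    (g : 'rV[R]_n -> R) : Prop :=
  compact (closure [set x | g x != 0]).

(* S^p *)
Definition sym_field (R : realType) (n p : nat) (f : tensor_field R n) : Prop :=
  [/\ forall I, size I != p -> f I = 0,
      forall I I', perm_eq I I' -> f I = f I' &
      forall I, smooth (f I) /\ compactly_supported (f I)].

(* bold S^m, the direct sum of S^0, ..., S^m *)
Definition graded_field (R : realType) (n m : nat) (F : tensor_field R n) :
    Prop :=
  (forall l : nat, (l <= m)%N -> sym_field l (part l F)) /\
  F = \sum_(0 <= l < m.+1) part l F.

Definition symmetrize (R : realType) (n : nat) (f : tensor_field R n) :
    tensor_field R n :=
  fun I x => ((size I)`!%:R)^-1 *
    \sum_(s : 'S_(size I))
      f [seq tnth (in_tuple I) (s j) | j <- enum 'I_(size I)] x.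

(* [tensor_delta f] has components f_{i_1...i_p} delta_{i_{p+1} i_{p+2}}; the  *)
(* list is reversed in order to read off its last two entries.                 *)
Definition tensor_delta (R : realType) (n : nat) (f : tensor_field R n) :
    tensor_field R n :=
  fun I x => if rev I is j :: i :: K then f (rev K) x * (i == j)%:R else 0.

Definition i_delta (R : realType) (n : nat) (f : tensor_field R n) :
    tensor_field R n :=
  symmetrize (tensor_delta f).

Definition unit_sphere (R : realType) (n : nat) (xi : 'rV[R]_n) : Prop :=
  \sum_(i < n) xi 0 i ^+ 2 = 1.

(* J^{m,k}; the components are continuous and compactly supported, so the      *)
(* Lebesgue integral over a line is the classical one.                         *)
Definition moment_ray (R : realType) (n m k : nat) (F : tensor_field R n)
    (x xi : 'rV[R]_n) : R :=
  \sum_(0 <= l < m.+1)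
    \int[@lebesgue_measure R]_(t in [set: R])
      (t ^+ k *
       \sum_(I : l.-tuple 'I_n)
          part l F I (x + t *: xi) * \prod_(i <- I) xi 0 i).

(* Main.v *)
Require Import Defs.
From mathcomp Require Import all_boot all_order all_algebra all_fingroup.
From mathcomp Require Import all_classical all_reals all_analysis.
From mathcomp Require Import measurable_realfun ring lra zify.
Import Order.TTheory GRing.Theory Num.Theory.
Import numFieldNormedType.Exports.
Local Open Scope classical_set_scope.
Local Open Scope ring_scope.
Set Implicit Arguments.
Unset Strict Implicit.
Unset Printing Implicit Defensive.

(** For a tensor field [T] of rank [d], write [T(y)[z]] for the homogeneous
    polynomial [sum T_(i_1 ... i_d)(y) z_(i_1) ... z_(i_d)] in the vector [z]
    ([homog]).  Since [i_delta] multiplies this polynomial by [|z|^2]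
    ([homog_i_delta]), the field [T_d = sum_j i_delta^j f^(d - 2 j)]
    ([homogenized]) satisfies, for [xi] on the unit sphere, that [T_d[xi]] is the
    sum of the [f^(l)[xi]] over all [l <= d] of the parity of [d].  The two
    equations of the theorem say that [T_m = 0] and [T_(m-1) = 0]
    ([homogenized_eq0]); if [m <= 1], these fields are the components of [F].

    Replacing [xi] by [-xi] multiplies the contribution of [f^(l)] to the [k]-th
    moment by [(-1)^(k + l)], so all moments of [F] vanish if and only if
    the moments of the even part and those of the odd part do
    ([moment_ray_parity]).  It remains to show, for [d <= m], that [T = T_d]
    vanishes as soon as the integrals of [t^k T(x + t xi)[xi]] over the line do,
    for [k <= m] ([homog_rays_eq0]).

    By homogeneity [xi] may be any nonzero vector ([homog_ray_rescale]).  In the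
    plane [x + u e + v w], where [w] is a vector of the standard basis, take the
    lines of direction [e + p w].  Then [T[e + p w]] is a polynomial
    [sum_j p^j g_j(u, v)] of degree at most [d] in [p], and the hypothesis is that
    the integral of [u^k sum_j p^j g_j(u, c + p u)] over [u] is zero, for all [c]
    and [p].  Multiplying by [c^r], integrating over [c], and substituting
    [v = c + p u] gives that the double integral of
    [u^k (v - p u)^r sum_j p^j g_j(u, v)] is zero ([ray_moments]).  For every [N]
    this says that [B(p, q)], the double integral of
    [(v - q u)^N sum_j p^j g_j(u, v)], vanishes to order [m + 1] on the diagonal.
    For fixed [q] it is a polynomial in [p] of degree at most [m] with a zero of
    order [m + 1] at [q], hence [B = 0] ([diagonal_moments_eq0]).  So all moments
    of all [g_j] are zero, and a continuous function with compact support and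
    zero moments is zero ([Cc_moments_eq0]).  In particular
    [g_0(0, 0) = T(x)[e]] is zero for every nonzero [e], and a symmetric
    tensor is determined by its polynomial ([homog_eq0]). *)

(** * Continuous functions with compact support *)

(** Compact support is expressed by vanishing outside a ball, which is easy to
    transport along the affine maps used below. *)
Definition Cc (R : realType) (V : normedModType R) (f : V -> R) : Prop :=
  continuous f /\ exists C : R, forall x, C < `|x| -> f x = 0.

Section CompactlySupported.
Context {R : realType}.
Implicit Types V W : normedModType R.
Notation mu := (@lebesgue_measure R).

Lemma Cc0 V : Cc (fun _ : V => 0 : R).
Proof. by split; [move=> x; exact: cvg_cst | exists 0]. Qed.

Lemma CcD V (f g : V -> R) : Cc f -> Cc g -> Cc (fun x => f x + g x).
Proof.
move=> [cf [A fA]] [cg [B gB]]; split.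
  by move=> x; apply: cvgD; [exact: cf | exact: cg].
exists (Num.max A B) => x; rewrite gt_max => /andP[Ax Bx].
by rewrite fA// gB// addr0.
Qed.

Lemma CcM V (h f : V -> R) : continuous h -> Cc f -> Cc (fun x => h x * f x).
Proof.
move=> ch [cf [A fA]]; split; last by exists A => x /fA ->; rewrite mulr0.
by move=> x; apply: cvgM; [exact: ch | exact: cf].
Qed.

Lemma CcZ V (a : R) (f : V -> R) : Cc f -> Cc (fun x => a * f x).
Proof. by apply: CcM => x; exact: cvg_cst. Qed.

Lemma Cc_sum V (I : Type) (r : seq I) (P : pred I) (F : I -> V -> R) :
  (forall i, P i -> Cc (F i)) -> Cc (fun x => \sum_(i <- r | P i) F i x).
Proof.
move=> FC; elim: r => [|i r IH].
  have -> : (fun x => \sum_(i <- [::] | P i) F i x) = fun=> 0.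
    by apply/funext => x; rewrite big_nil.
  exact: Cc0.
have -> : (fun x => \sum_(j <- i :: r | P j) F j x) = fun x => if P i then
    F i x + \sum_(j <- r | P j) F j x else \sum_(j <- r | P j) F j x.
  by apply/funext => x; rewrite big_cons.
by case: (P i) (FC i) => // /(_ isT) Fi; exact: CcD.
Qed.

(** The second hypothesis says that [phi] is proper. *)
Lemma Cc_comp V W (phi : V -> W) (f : W -> R) : continuous phi ->
  (forall C : R, exists C' : R, forall x, `|phi x| <= C -> `|x| <= C') ->
  Cc f -> Cc (f \o phi).
Proof.
move=> cphi pphi [cf [C fC]]; split.
  by move=> x; apply: continuous_comp; [exact: cphi | exact: cf].
have [C' phiC'] := pphi C; exists C' => x C'x; apply: fC.
by rewrite ltNge; apply/negP => /phiC'; rewrite leNgt C'x.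
Qed.

Lemma Cc_bounded V (f : V -> R) :
  (forall C : R, exists2 K : set V, compact K & [set x | `|x| <= C] `<=` K) ->
  Cc f -> exists2 M : R, 0 <= M & forall x, `|f x| <= M.
Proof.
move=> bK [cf [C fC]]; have [K cK CK] := bK C.
have : compact (f @` K).
  by apply: continuous_compact => //; apply: continuous_subspaceT => x; exact: cf.
move=> /compact_bounded[M [_ /(_ (M + 1))]].
rewrite ltrDl ltr01 => /(_ isT) fM.
exists `|M + 1| => // x.
have [/fC ->|xC] := ltP C `|x|; first by rewrite normr0.
apply: le_trans (ler_norm _); apply: fM; exists x => //; exact: CK.
Qed.

Lemma line_ball_compact (C : R) :
  exists2 K : set R, compact K & [set x : R | `|x| <= C] `<=` K.
Proof.
exists (`[- C, C]%classic); first exact: segment_compact.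
by move=> x /=; rewrite in_itv/= -ler_norml.
Qed.

Lemma plane_ball_compact (C : R) :
  exists2 K : set (R * R), compact K & [set x : R * R | `|x| <= C] `<=` K.
Proof.
have [K cK CK] := line_ball_compact C.
exists (K `*` K); first exact: compact_setX.
by move=> x /=; rewrite prod_normE ge_max => /andP[x1 x2]; split; exact: CK.
Qed.

Lemma Cc_integrable (f : R -> R) : Cc f -> mu.-integrable setT (EFin \o f).
Proof.
move=> [cf [C fC]].
have -> : f = f \_ `[-C, C].
  apply/funext => x; rewrite patchE; case: ifPn => //.
  rewrite notin_setE/= in_itv/= -ler_norml => /negP; rewrite -ltNge => /fC ->//.
have -> : EFin \o f \_ `[-C, C] = (EFin \o f) \_ `[-C, C].
  by rewrite restrict_EFin.
apply: (iffLR (integrable_mkcond _ _)) => //.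
apply: continuous_compact_integrable; first exact: segment_compact.
by apply: continuous_subspaceT => x; exact: cf.
Qed.

(** The right-hand side is a measure in [A], so by uniqueness of the Lebesgue
    measure it is enough to compare lengths of intervals. *)
Lemma lebesgue_measure_affine (a b : R) (A : set R) (phi := fun t => a * t + b) :
  a != 0 -> measurable A ->
  mu A = (`|a|%:E * mu (phi @^-1` A))%E.
Proof.
move=> a0 mA.
have mphi : measurable_fun [set: measurableTypeR R] (phi : _ -> measurableTypeR R).
  apply: continuous_measurable_fun => t; apply: cvgD; last exact: cvg_cst.
  by apply: cvgM; [exact: cvg_cst|exact: cvg_id].
have [nu nuE] : exists nu : {measure set (measurableTypeR R) -> \bar R},
    forall B, nu B = (`|a|%:E * mu (phi @^-1` B))%E.
  unshelve eexists (mscale (NngNum (normr_ge0 a)) (pushforward mu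
    (phi : measurableTypeR R -> measurableTypeR R))) => //.
rewrite -nuE; apply: lebesgue_measure_unique => // _ [[c d]] _ <-.
rewrite nuE/=.
have phiE : phi @^-1` `]c, d] = if 0 < a then `](c - b) / a, (d - b) / a]%classic
   else `[(d - b) / a, (c - b) / a[%classic.
  apply/seteqP; split => t /=; rewrite /phi; case: ifPn => a1 /=; rewrite !in_itv/=.
  - by rewrite ltr_pdivrMr// ler_pdivlMr// ltrBlDr lerBrDr mulrC.
  - have {}a1 : a < 0 by rewrite lt_neqAle a0 leNgt.
    rewrite ler_ndivrMr// ltr_ndivlMr// lerBrDr ltrBlDr mulrC => /andP[-> ->]//.
  - by rewrite ltr_pdivrMr// ler_pdivlMr// ltrBlDr lerBrDr mulrC.
  - have {}a1 : a < 0 by rewrite lt_neqAle a0 leNgt.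
    rewrite ler_ndivrMr// ltr_ndivlMr// lerBrDr ltrBlDr mulrC => /andP[-> ->]//.
rewrite phiE; case: ifPn => a1.
  rewrite !lebesgue_measure_itv/= !lte_fin ltr_pM2r ?invr_gt0// ltrD2r.
  case: ifPn => cd; last by rewrite mule0.
  by rewrite -EFinB -EFinM gtr0_norm//; congr EFin; field.
have {}a1 : a < 0 by rewrite lt_neqAle a0 leNgt.
rewrite !lebesgue_measure_itv/= !lte_fin ltr_nM2r ?invr_lt0// ltrD2r.
case: ifPn => cd; last by rewrite mule0.
by rewrite -EFinB -EFinM ltr0_norm//; congr EFin; field.
Qed.

(** Rounding the first coordinate down to a multiple of [1 / (n + 1)] gives
    functions that are measurable for the product sigma-algebra, since each of
    them is, on countably many vertical strips, a continuous function of the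
    second coordinate; they converge pointwise to [f]. *)
Lemma continuous_measurable2 (f : R * R -> R) : continuous f ->
  measurable_fun [set: measurableTypeR R * measurableTypeR R] f.
Proof.
move=> cf.
pose h (n : nat) (z : R * R) : R * R :=
  ((Num.floor (z.1 * n.+1%:R))%:~R / n.+1%:R, z.2).
apply: (@measurable_fun_cvg _ _ _ _ (fun n => f \o h n)).
  move=> n _ Y mY; rewrite setTI.
  have -> : (f \o h n) @^-1` Y = \bigcup_(k in [set: int])
    ((`[k%:~R / n.+1%:R, (k + 1)%:~R / n.+1%:R[) `*`
     ((fun v => f (k%:~R / n.+1%:R, v)) @^-1` Y)).
    apply/seteqP; split => [[u v] /= fY|[u v] /= [k _] /= [+ fY]].
      exists (Num.floor (u * n.+1%:R)) => //=; split => //=.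
      rewrite in_itv/= ler_pdivrMr// ltr_pdivlMr//.
      exact: floor_itv.
    rewrite in_itv/= ler_pdivrMr// ltr_pdivlMr// => /floor_def ku.
    by rewrite /h/= ku.
  apply: countable_bigcupT_measurable => // k.
  have mk : measurable (`[k%:~R / n.+1%:R, (k + 1)%:~R / n.+1%:R[ : set R).
    exact: measurable_itv.
  have mY' : measurable ((fun v => f (k%:~R / n.+1%:R, v)) @^-1` Y).
    rewrite -[X in measurable X]setTI; apply: continuous_measurable_fun => //.
    move=> v; apply: continuous_comp; last exact: cf.
    exact: (cvg_pair (cvg_cst _) cvg_id).
  exact: (measurableX mk mY').
move=> [u v] _; apply: continuous_cvg; first exact: cf.
have c1 : (fun n => (Num.floor (u * n.+1%:R))%:~R / n.+1%:R : R) @ \oo --> u.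
  apply/cvgrPdist_lt => e e0.
  apply: filterS (near_infty_natSinv_lt (PosNum e0)) => n /=.
  apply: le_lt_trans.
  have /andP[l1 l2] := floor_itv (u * n.+1%:R).
  have n0 : 0 < n.+1%:R :> R by [].
  rewrite ger0_norm ?subr_ge0 ?ler_pdivrMr//.
  rewrite lerBlDr -[X in _ <= X + _]mul1r -mulrDl ler_pdivlMr//.
  by move: l2; rewrite intrD addrC => /ltW.
exact: (cvg_pair c1 (cvg_cst v)).
Qed.

Lemma continuous_affine (a b : R) : continuous (fun t : R => a * t + b).
Proof.
move=> t; apply: cvgD; last exact: cvg_cst.
by apply: cvgM; [exact: cvg_cst|exact: cvg_id].
Qed.

Lemma Cc_affine (f : R -> R) (a b : R) : a != 0 -> Cc f ->
  Cc (fun t => f (a * t + b)).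
Proof.
move=> a0; apply: (@Cc_comp _ _ (fun t => a * t + b)).
  exact: continuous_affine.
move=> C; exists ((C + `|b|) / `|a|) => t tC.
rewrite ler_pdivlMr ?normr_gt0// mulrC -normrM.
rewrite -[a * t](addrK b); apply: le_trans (ler_normB _ _) _.
by rewrite lerD2r.
Qed.

Lemma ge0_integral_affine (g : R -> \bar R) (a b : R) : a != 0 ->
  measurable_fun setT g -> (forall t, 0 <= g t)%E ->
  (\int[mu]_t g t = `|a|%:E * \int[mu]_t g (a * t + b)%R)%E.
Proof.
move=> a0 mg g0.
pose phi t := a * t + b.
have mphi : measurable_fun [set: measurableTypeR R] (phi : _ -> measurableTypeR R).
  by apply: continuous_measurable_fun; exact: continuous_affine.
have [nu [munu nug]] : exists nu : {measure set (measurableTypeR R) -> \bar R},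
    (forall A, measurable A -> mu A = nu A) /\
    (\int[nu]_t g t = `|a|%:E * \int[mu]_t g (phi t))%E.
  unshelve eexists (mscale (NngNum (normr_ge0 a)) (pushforward mu
    (phi : measurableTypeR R -> measurableTypeR R))) => //.
  split; first by move=> A mA; rewrite (lebesgue_measure_affine b a0 mA).
  rewrite ge0_integral_mscale//; congr (_ * _)%E.
  by rewrite ge0_integral_pushforward.
by rewrite -nug; apply: eq_measure_integral => // A mA _; exact: munu.
Qed.

Lemma Rintegral_affine (f : R -> R) (a b : R) : a != 0 -> Cc f ->
  \int[mu]_(t in setT) f t = `|a| * \int[mu]_(t in setT) f (a * t + b).
Proof.
move=> a0 Ccf; have if1 := Cc_integrable Ccf.
have if2 := Cc_integrable (Cc_affine b a0 Ccf).
have mf := measurable_int _ if1.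
have -> : `|a| = fine `|a|%:E by [].
rewrite /Rintegral -fineM//; last exact: integrable_fin_num.
congr fine; rewrite [in LHS]integralE [in RHS]integralE.
rewrite (ge0_integral_affine b a0)//; last exact: measurable_funepos.
rewrite [X in (_ - X)%E](ge0_integral_affine b a0)//; last exact: measurable_funeneg.
have dist (x y : \bar R) : x \is a fin_num ->
    (`|a|%:E * x - `|a|%:E * y = `|a|%:E * (x - y))%E.
  by move=> xfin; rewrite muleBr//; exact: fin_num_adde_defr.
rewrite -[RHS]dist; last exact: (integrable_pos_fin_num _ if2).
by congr (_ * _ - _ * _)%E; apply: eq_integral => t _; rewrite ?funeposE ?funenegE.
Qed.

Lemma Cc_integrable2 (f : R * R -> R) : Cc f ->
  (mu \x mu)%E.-integrable setT (EFin \o f).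
Proof.
move=> Ccf; have [M M0 fM] := Cc_bounded plane_ball_compact Ccf; case: Ccf => cf [C fC].
pose K : set R := `[-C, C]%classic.
have mK : measurable K by exact: measurable_itv.
have -> : EFin \o f = (EFin \o f) \_ (K `*` K).
  apply/funext => -[u v]; rewrite patchE; case: ifPn => //.
  rewrite notin_setE/= => uvK; congr EFin; apply: fC.
  rewrite prod_normE/= lt_max; apply/orP.
  have [uC|uC] := ltP C `|u|; first by left.
  right; rewrite ltNge; apply/negP => vC; apply: uvK.
  by split; rewrite /K/= in_itv/= -ler_norml.
have mKK := measurableX mK mK.
apply: (iffLR (integrable_mkcond _ _)); first exact: mKK.
apply: measurable_bounded_integrable; first exact: mKK.
- apply: (@le_lt_trans _ _ (mu K * mu K)%E).
    by rewrite -(product_measure1E mu mu mK mK).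
  rewrite /K lebesgue_measure_itv/=.
  by case: ifPn => // _; rewrite ?mule0// -EFinB -EFinM ltry.
- apply: (measurable_funS _ (@subsetT _ _)) => //.
  exact: (continuous_measurable2 cf).
- exists M; split; first exact: num_real.
  by move=> N MN z _; apply: le_trans (fM z) (ltW MN).
Qed.

Lemma Cc_sectionl (f : R * R -> R) (u : R) : Cc f -> Cc (fun v => f (u, v)).
Proof.
apply: (@Cc_comp _ _ (fun v => (u, v))).
  by move=> v; exact: (cvg_pair (cvg_cst _) cvg_id).
by move=> C; exists C => v; rewrite prod_normE/= ge_max => /andP[].
Qed.

Lemma Cc_sectionr (f : R * R -> R) (v : R) : Cc f -> Cc (fun u => f (u, v)).
Proof.
apply: (@Cc_comp _ _ (fun u => (u, v))).
  by move=> u; exact: (cvg_pair cvg_id (cvg_cst _)).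
by move=> C; exists C => u; rewrite prod_normE/= ge_max => /andP[].
Qed.

Lemma Cc_fubini (f : R * R -> R) : Cc f ->
  \int[mu]_(u in setT) (\int[mu]_(v in setT) f (u, v)) =
  \int[mu]_(v in setT) (\int[mu]_(u in setT) f (u, v)).
Proof.
move=> Ccf; have := Fubini (Cc_integrable2 Ccf).
have E1 u : (\int[mu]_v (f (u, v))%:E)%E = (\int[mu]_(v in setT) f (u, v))%:E.
  rewrite /Rintegral fineK//; apply: integrable_fin_num => //.
  exact: (Cc_integrable (Cc_sectionl u Ccf)).
have E2 v : (\int[mu]_u (f (u, v))%:E)%E = (\int[mu]_(u in setT) f (u, v))%:E.
  rewrite /Rintegral fineK//; apply: integrable_fin_num => //.
  exact: (Cc_integrable (Cc_sectionr v Ccf)).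
move=> /(congr1 fine) /=.
under eq_integral do rewrite E1.
under [in RHS]eq_integral do rewrite E2.
by [].
Qed.

Lemma integrable_cst_itv (M a b : R) :
  mu.-integrable setT (EFin \o (fun t => M * \1_(`[a, b]) t)).
Proof.
have -> : EFin \o (fun t => M * \1_(`[a, b]) t) =
  (fun t => M%:E * (EFin \o \1_(`[a, b])) t)%E.
  by apply/funext => t /=; rewrite EFinM.
by apply: integrableZl => //; exact: integrable_indic_itv.
Qed.

Lemma Cc_integral_section (f : R * R -> R) : Cc f ->
  Cc (fun u => \int[mu]_(v in setT) f (u, v)).
Proof.
move=> Ccf; have [M M0 fM] := Cc_bounded plane_ball_compact Ccf; split.
  have [cf [C fC]] := Ccf.
  move=> a.
  have aI : a \in `]a - 1, a + 1[%classic.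
    by rewrite inE/= in_itv/= ltrBlDr ltrDl ltr01.
  apply: (@continuity_under_integral _ _ _ mu (fun u v => f (u, v)) setT
     measurableT (a - 1) (a + 1) _ _ _ (integrable_cst_itv M (- C) C)) => //.
  - by move=> u _; exact: (Cc_integrable (Cc_sectionl u Ccf)).
  - apply: aeW => v _ u _.
    by have [+ _] := Cc_sectionr v Ccf; exact.
  - move=> u _; apply: aeW => v _ /=.
    rewrite indicE; case: (boolP (v \in _)) => [_|]; first by rewrite mulr1.
    rewrite notin_setE/= in_itv/= -ler_norml => /negP; rewrite -ltNge => vC.
    by rewrite fC ?normr0 ?mulr0// prod_normE lt_max/= vC orbT.
have [cf [C fC]] := Ccf.
exists C => u uC; rewrite /Rintegral integral0_eq// => v _.
by rewrite fC// prod_normE lt_max/= uC.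
Qed.

Lemma Rintegral_cst_itv (M a b : R) : a <= b ->
  \int[mu]_(t in setT) (M * \1_(`[a, b]) t) = M * (b - a).
Proof.
move=> ab; rewrite RintegralZl//; last exact: integrable_indic_itv.
rewrite /Rintegral integral_indic// setIT/= lebesgue_measure_itv/= lte_fin.
case: ifPn => //; rewrite -leNgt => ba.
by rewrite /= (@le_anti _ _ a b) ?ab ?ba// subrr.
Qed.

Lemma RintegralD_Cc (f g : R -> R) : Cc f -> Cc g ->
  \int[mu]_(t in setT) (f t + g t) =
  \int[mu]_(t in setT) f t + \int[mu]_(t in setT) g t.
Proof. by move=> Cf Cg; rewrite RintegralD//; exact: Cc_integrable. Qed.

Lemma RintegralZ_Cc (a : R) (f : R -> R) : Cc f ->
  \int[mu]_(t in setT) (a * f t) = a * \int[mu]_(t in setT) f t.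
Proof. by move=> Cf; rewrite RintegralZl//; exact: Cc_integrable. Qed.

Lemma Rintegral_sum_Cc (I : Type) (r : seq I) (P : pred I) (F : I -> R -> R) :
  (forall i, Cc (F i)) ->
  \int[mu]_(t in setT) (\sum_(i <- r | P i) F i t) =
  \sum_(i <- r | P i) \int[mu]_(t in setT) F i t.
Proof.
move=> CF; elim: r => [|i r IH].
  under eq_Rintegral do rewrite big_nil.
  by rewrite big_nil Rintegral_cst// mul0r.
under eq_Rintegral do rewrite big_cons.
rewrite big_cons; case: ifP => // Pi.
by rewrite RintegralD_Cc ?IH//; exact: Cc_sum.
Qed.

Lemma bernoulli_exp (x : R) (N : nat) : 0 <= x -> 1 + N%:R * x <= (1 + x) ^+ N.
Proof.
move=> x0; elim: N => [|N IH]; first by rewrite mul0r addr0 expr0.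
rewrite exprS; apply: le_trans (ler_wpM2l _ IH); last by rewrite addr_ge0.
have : 0 <= N%:R * x ^+ 2 by rewrite mulr_ge0// sqr_ge0.
by rewrite -natr1; lra.
Qed.

(** The integral of [p f] is zero for every polynomial [p].  If [f t0 > 0],
    take for [p] the powers of a quadratic polynomial [q] that is larger than
    [1 + x], with [x > 0], near [t0], and between [0] and [1] at the points of the
    support where [f] may be negative: the contribution of the neighbourhood of
    [t0] then tends to infinity, and the rest stays bounded. *)
Lemma Cc_moments_eq0 (f : R -> R) : Cc f ->
  (forall k, \int[mu]_(t in setT) (t ^+ k * f t) = 0) -> forall t, f t = 0.
Proof.
have continuousX k : continuous (fun t : R => t ^+ k) by exact: exprn_continuous.
have poly0 (h : R -> R) (p : {poly R}) : Cc h ->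
    (forall k, \int[mu]_(t in setT) (t ^+ k * h t) = 0) ->
    \int[mu]_(t in setT) (p.[t] * h t) = 0.
  move=> Ch h0.
  under eq_Rintegral.
    move=> t _; rewrite horner_coef mulr_suml.
    under eq_bigr do rewrite -mulrA.
  over.
  rewrite Rintegral_sum_Cc; last first.
    by move=> i; apply: CcZ; apply: CcM => //.
  rewrite big1// => i _; rewrite RintegralZ_Cc ?h0 ?mulr0//.
  by apply: CcM.
(* Changing [f] into [- f], one may assume that [f] is positive somewhere. *)
wlog pos : f / exists t0, 0 < f t0.
  move=> H Cf f0 t0; apply: contrapT => /eqP; rewrite neq_lt => /orP[ft0|ft0].
    have CNf : Cc (fun t => - f t).
      rewrite (_ : (fun _ => _) = (fun t => -1 * f t)); first exact: CcZ.
      by apply/funext => t; rewrite mulN1r.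
    have ex0 : exists t0, 0 < - f t0 by exists t0; rewrite oppr_gt0.
    have Nf0 k : \int[mu]_(t in setT) (t ^+ k * - f t) = 0.
      under eq_Rintegral do rewrite mulrN -mulN1r.
      by rewrite RintegralZ_Cc ?f0 ?mulr0//; exact: CcM.
    have := H _ ex0 CNf Nf0 t0; lra.
  have := H f (ex_intro _ t0 ft0) Cf f0 t0; lra.
move=> Cf f0; exfalso; move: pos => [t0 ft0].
have [M M0 fM] := Cc_bounded line_ball_compact Cf.
have [cf [C fC]] := Cf.
have C0 : `|t0| <= C by rewrite leNgt; apply/negP => /fC ft00; rewrite ft00 ltxx in ft0.
(* On the ball of radius [d] around [t0] the function stays above [e]. *)
pose e := f t0 / 2.
have e0 : 0 < e by rewrite divr_gt0.
have [d d0 fd] : exists2 d : R, 0 < d & forall t, `|t - t0| < d -> e < f t.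
  have /cvgrPdist_lt/(_ e e0) := cf t0.
  move=> [d /= d0 fd]; exists d => // t td.
  have := fd t; rewrite /= (distrC t0 t) => /(_ td).
  rewrite ltr_norml => /andP[_]; rewrite /e; lra.
(* [B] bounds the distance from [t0] to any point of the support, so that
   [q] is nonnegative there; [x] is half of the maximum of [q - 1], and
   [q >= 1 + x] on the ball of radius [d / 2]. *)
pose B := `|t0| + C + d.
have B0 : 0 < B by rewrite ltr_wpDl// addr_ge0//; exact: le_trans C0.
pose x := d ^+ 2 / (2 * B ^+ 2).
have x0 : 0 < x by rewrite divr_gt0 ?mulr_gt0 ?exprn_gt0.
pose q : {poly R} := 1 + (d ^+ 2 / B ^+ 2)%:P - (B ^- 2) *: ('X - t0%:P) ^+ 2.
have qE t : q.[t] = 1 + (d ^+ 2 - (t - t0) ^+ 2) / B ^+ 2.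
  rewrite /q !(hornerE, horner_exp) /=; field; exact: lt0r_neq0.
(* The integral of [q^N f], which is zero, is at least that of a step function. *)
have main N : (1 + N%:R * x) * e * d <= M * (2 * C).
  rewrite -subr_le0.
  have := poly0 f (q ^+ N) Cf f0 => <-.
  have <- : \int[mu]_(t in setT) ((1 + N%:R * x) * e * \1_(`[t0 - d / 2, t0 + d / 2]) t
     - M * \1_(`[- C, C]) t) = (1 + N%:R * x) * e * d - M * (2 * C).
    rewrite RintegralB//; try exact: integrable_cst_itv.
    have l1 : t0 - d / 2 <= t0 + d / 2 by lra.
    have l2 : - C <= C by have := normr_ge0 t0; lra.
    by rewrite !Rintegral_cst_itv//; congr (_ * _ - _ * _); lra.
  apply: le_Rintegral => //.
  - have := integrableB (measurableT : measurable [set: measurableTypeR R])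
      (integrable_cst_itv ((1 + N%:R * x) * e) (t0 - d / 2) (t0 + d / 2))
      (integrable_cst_itv M (- C) C).
    by apply: eq_integrable.
  - apply: Cc_integrable; apply: CcM => // t; exact: continuous_horner.
  move=> t _; rewrite horner_exp.
  have [tC|tC] := ltP C `|t|.
    rewrite fC// mulr0 indicE memNset; last first.
      move=> /=; rewrite in_itv/= => tt0.
      have : e < f t by apply: fd; rewrite ltr_norml; lra.
      by rewrite fC//; lra.
    by rewrite mulr0 sub0r oppr_le0 mulr_ge0// indicE; case: (_ \in _).
  have -> : \1_(`[- C, C]) t = 1 :> R.
    by rewrite indicE mem_set//= in_itv/= -ler_norml.
  have tB : (t - t0) ^+ 2 / B ^+ 2 <= 1.
    rewrite ler_pdivrMr ?exprn_gt0// mul1r -[leLHS]real_normK ?num_real//.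
    rewrite lerXn2r ?nnegrE ?(ltW B0)//.
    by apply: le_trans (ler_normB _ _) _; rewrite /B; lra.
  have xE : d ^+ 2 / B ^+ 2 = 2 * x by rewrite /x; field; exact: lt0r_neq0.
  have q0 : 0 <= q.[t] by rewrite qE mulrBl xE; lra.
  have dd (r s : R) : 0 < r -> 0 <= s -> (s ^+ 2 <= r ^+ 2) = (s <= r).
    by move=> r0 s0; rewrite ler_pXn2r// nnegrE ltW.
  case: (boolP (t \in `[t0 - d / 2, t0 + d / 2]%classic)) => [|tn].
    rewrite inE/= in_itv/= => td2.
    have tdn : `|t - t0| <= d / 2 by rewrite ler_norml; lra.
    have eft : e < f t by apply: fd; lra.
    rewrite indicE mem_set ?mulr1/=; last by rewrite in_itv/=; lra.
    have Nx0 : 0 <= N%:R * x by rewrite mulr_ge0// ltW.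
    apply: le_trans (_ : (1 + N%:R * x) * e <= _); first by lra.
    apply: ler_pM; [lra|lra| |lra].
    apply: le_trans (bernoulli_exp _ (ltW x0)) _.
    rewrite lerXn2r ?nnegrE//; first by lra.
    rewrite qE mulrBl xE.
    have : (t - t0) ^+ 2 / B ^+ 2 <= x.
      have -> : x = d ^+ 2 / 2 / B ^+ 2 by rewrite /x; field; exact: lt0r_neq0.
      rewrite ler_pM2r ?invr_gt0 ?exprn_gt0//.
      rewrite -[leLHS]real_normK ?num_real//.
      apply: le_trans (_ : (d / 2) ^+ 2 <= _).
        by rewrite dd//; lra.
      have : 0 < d ^+ 2 by rewrite exprn_gt0.
      by rewrite expr_div_n; lra.
    lra.
  rewrite [\1_(`[t0 - _, _]) t]indicE (negbTE tn) mulr0 sub0r mulr1.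
  have [td|td] := ltP `|t - t0| d.
    have eft := fd _ td.
    apply: le_trans (_ : 0 <= _); first by lra.
    by rewrite mulr_ge0 ?exprn_ge0//; lra.
  have q1 : q.[t] <= 1.
    rewrite qE mulrBl; rewrite gerDl subr_le0 ler_pM2r ?invr_gt0 ?exprn_gt0//.
    by rewrite -[leRHS]real_normK ?num_real// lerXn2r ?nnegrE// ltW.
  have : `|q.[t] ^+ N * f t| <= M.
    rewrite normrM -[leRHS]mul1r ler_pM// ger0_norm ?exprn_ge0//.
    exact: exprn_ile1.
  by rewrite ler_norml => /andP[].
have xed : 0 < x * e * d by apply: mulr_gt0; [exact: mulr_gt0|].
have bnd0 : 0 <= M * (2 * C) / (x * e * d).
  have := normr_ge0 t0 => t00.
  by apply: divr_ge0; [apply: mulr_ge0 => //; lra|exact: ltW].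
have := archi_boundP bnd0.
rewrite ltr_pdivrMr//; set N := Num.bound _ => H.
have ed0 : 0 < e * d by rewrite mulr_gt0.
have := main N; lra.
Qed.

Lemma continuous_fst_exp (a : nat) : continuous (fun z : R * R => z.1 ^+ a).
Proof.
have -> : (fun z : R * R => z.1 ^+ a) = (fun t : R => t ^+ a) \o fst by [].
by move=> z; apply: continuous_comp; [exact: cvg_fst|exact: exprn_continuous].
Qed.

Lemma continuous_snd_exp (b : nat) : continuous (fun z : R * R => z.2 ^+ b).
Proof.
have -> : (fun z : R * R => z.2 ^+ b) = (fun t : R => t ^+ b) \o snd by [].
by move=> z; apply: continuous_comp; [exact: cvg_snd|exact: exprn_continuous].
Qed.

(** The one-variable statement applies twice: to the [b]-th moment of [f] in the
    second variable, as a function of the first variable, and then to the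
    sections of [f]. *)
Lemma Cc_moments2_eq0 (f : R * R -> R) : Cc f ->
  (forall a b, \int[mu]_(u in setT) (\int[mu]_(v in setT)
     (u ^+ a * v ^+ b * f (u, v))) = 0) -> forall z, f z = 0.
Proof.
move=> Cf f0 [u v].
have Cvb b : Cc (fun z : R * R => z.2 ^+ b * f z).
  by apply: CcM => //; exact: continuous_snd_exp.
apply: (@Cc_moments_eq0 (fun v => f (u, v))); first exact: Cc_sectionl.
move=> b; have Cb := Cc_integral_section (Cvb b).
apply: (Cc_moments_eq0 Cb) => a.
rewrite -[RHS](f0 a b); apply: eq_Rintegral => s _.
rewrite -RintegralZ_Cc; last exact: (Cc_sectionl s (Cvb b)).
by apply: eq_Rintegral => t _; rewrite mulrA.
Qed.

End CompactlySupported.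

(** * Polynomials vanishing to high order on the diagonal *)

Lemma mul_bin_swap (N k i : nat) : (k + i <= N)%N ->
  ('C(N, k + i) * 'C(k + i, k) = 'C(N, k) * 'C(N - k, i))%N.
Proof.
move=> kiN.
have kN : (k <= N)%N by exact: leq_trans (leq_addr _ _) kiN.
have iN : (i <= N - k)%N by rewrite leq_subRL.
have F : (0 < k`! * i`! * (N - k - i)`!)%N by rewrite !muln_gt0 !fact_gt0.
apply/eqP; rewrite -(eqn_pmul2r F); apply/eqP.
have E1 := bin_fact kiN; have E2 := bin_fact (leq_addr i k).
have E3 := bin_fact kN; have E4 := bin_fact iN.
rewrite addKn in E2; rewrite subnDA in E1.
rewrite -E2 in E1; rewrite -E4 -E1 in E3.
transitivity ('C(N, k + i) * ('C(k + i, k) * (k`! * i`!) * (N - k - i)`!))%N.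
  by rewrite -!mulnA.
by rewrite -E3 -!mulnA; congr (_ * _)%N; rewrite mulnCA.
Qed.

Section Algebra.
Context {R : realFieldType}.

Lemma horner_eq0 (p : {poly R}) : (forall x, p.[x] = 0) -> p = 0.
Proof.
move=> p0; apply: (@roots_geq_poly_eq0 _ _ [seq i%:R | i <- iota 0 (size p)]).
- by apply/allP => x _; rewrite /root p0.
- by rewrite map_inj_uniq ?iota_uniq// => i j /eqP; rewrite eqr_nat => /eqP.
- by rewrite size_map size_iota.
Qed.

Lemma coef_sum_exp_eq0 (d : nat) (a : nat -> R) :
  (forall x, \sum_(j < d) a j * x ^+ j = 0) -> forall j, (j < d)%N -> a j = 0.
Proof.
move=> a0; have : \poly_(j < d) a j = 0.
  by apply: horner_eq0 => x; rewrite horner_poly.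
by move=> /polyP pE j jd; have := pE j; rewrite coef_poly jd coef0.
Qed.

(** Think of [mom j a b] as the moment of order [(a, b)] of a function [g_j] of
    [(u, v)].  The inner sum is then the integral of [u^k (v - p u)^r g_j].  For
    fixed [N], [B N j] below is the polynomial whose value at [q] is the integral
    of [(v - q u)^N g_j]; its [k]-th derivative is, up to a nonzero factor, the
    integral of [u^k (v - q u)^(N - k) g_j].  The hypothesis therefore says that
    [sum_j p^j (B N j)(q)] and its first [m] derivatives in [q] vanish at [q = p].
    By the Taylor formula this sum is divisible by [(p - q)^(m + 1)] as a polynomial
    in [p]; its degree in [p] is at most [d], so it is zero. *)
Lemma diagonal_moments_eq0 (m d : nat) (mom : nat -> nat -> nat -> R) :
  (d <= m)%N ->
  (forall k r p, (k <= m)%N -> \sum_(j < d.+1) p ^+ j *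
     (\sum_(i < r.+1) (- p) ^+ i * mom j (k + i)%N (r - i)%N *+ 'C(r, i)) = 0) ->
  forall j a b, (j <= d)%N -> mom j a b = 0.
Proof.
move=> dm H.
pose B N j : {poly R} := \poly_(i < N.+1) ((-1) ^+ i * mom j i (N - i)%N *+ 'C(N, i)).
have B0 N k p : (k <= m)%N -> \sum_(j < d.+1) p ^+ j * (B N j)^`N(k).[p] = 0.
  move=> km; have [kN|Nk] := leqP k N; last first.
    rewrite big1// => j _.
    rewrite nderivn_poly0 ?horner0 ?mulr0//.
    exact: leq_trans (size_poly _ _) Nk.
  have Hk := H k (N - k)%N p km.
  rewrite -[RHS](mul0r ((-1) ^+ k *+ 'C(N, k))) -[in RHS]Hk mulr_suml.
  apply: eq_bigr => j _; rewrite -mulrA.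
  congr (_ * _); rewrite mulr_suml.
  have sz : (size (B N j)^`N(k) <= (N - k).+1)%N.
    apply/leq_sizeP => i iN; rewrite coef_nderivn coef_poly.
    by rewrite ifF ?mul0rn//; lia.
  rewrite (horner_coef_wide _ sz); apply: eq_bigr => i _.
  rewrite coef_nderivn coef_poly ifT; last by have := ltn_ord i; lia.
  rewrite -subnDA (exprNn p i) exprD.
  (* The rest is the identity [mul_bin_swap] between binomial coefficients. *)
  rewrite -(mulr_natr _ 'C(N - k, i)) -(mulr_natr _ 'C(N, k)).
  rewrite -(mulr_natr _ 'C(k + i, k)) -(mulr_natr _ 'C(N, k + i)).
  have E : ('C(N, k + i)%:R * 'C(k + i, k)%:R) = ('C(N, k)%:R * 'C(N - k, i)%:R) :> R.
    by rewrite -!natrM mul_bin_swap//; have := ltn_ord i; lia.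
  move: E; move: ('C(N, k + i)%:R : R) ('C(k + i, k)%:R : R) ('C(N, k)%:R : R)
    ('C(N - k, i)%:R : R) => x1 x2 x3 x4 E.
  move: ((-1) ^+ k : R) ((-1) ^+ i : R) (mom _ _ _) (p ^+ i) => s1 s2 y z.
  transitivity (s1 * s2 * y * z * (x1 * x2)); first by ring.
  by rewrite E; ring.
(* [W] is the sum above as a polynomial in [p], for fixed [q]; [E k] is the
   coefficient of [(q - p)^k] in its Taylor expansion. *)
have W0 N q j : (j < d.+1)%N -> (B N j).[q] = 0.
  pose E k : {poly R} := \sum_(j < d.+1) 'X^j * (B N j)^`N(k).
  pose W : {poly R} := \poly_(j < d.+1) (B N j).[q].
  have E0 k : (k <= m)%N -> E k = 0.
    move=> km; apply: horner_eq0 => p; rewrite horner_sum -[RHS](B0 N k p km).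
    by apply: eq_bigr => i _; rewrite hornerM hornerXn.
  have WE : W = \sum_(k < N.+1) (q%:P - 'X) ^+ k * E k.
    apply/eqP; rewrite -subr_eq0; apply/eqP; apply: horner_eq0 => p.
    rewrite hornerD hornerN horner_poly horner_sum.
    rewrite [X in X - _](_ : _ = \sum_(i < d.+1) \sum_(k < N.+1)
       (q - p) ^+ k * (p ^+ i * (B N i)^`N(k).[p])).
      rewrite exchange_big -sumrB big1//= => k _.
      rewrite hornerM horner_exp hornerD hornerN hornerC hornerX horner_sum.
      rewrite -mulr_sumr; apply/eqP; rewrite subr_eq0; apply/eqP; congr (_ * _).
      by apply: eq_bigr => i _; rewrite hornerM hornerXn.
    apply: eq_bigr => i _.
    have -> : (B N i).[q] = (B N i).[p + (q - p)] by rewrite [p + _]addrC subrK.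
    rewrite (nderiv_taylor_wide (mulrC _ _) (size_poly _ _)) mulr_suml.
    by apply: eq_bigr => k _; rewrite mulrAC mulrC [in LHS](mulrC _ (p ^+ i)).
  have : ('X - q%:P) ^+ m.+1 %| W.
    rewrite WE; apply: (big_ind (fun P => ('X - q%:P) ^+ m.+1 %| P)).
    - exact: dvdp0.
    - by move=> P Q; exact: dvdp_add.
    move=> k _; have [km|mk] := leqP k m; first by rewrite E0// mulr0 dvdp0.
    rewrite -(opprB 'X) exprNn; apply: dvdp_mulr; apply: dvdp_mull.
    exact: dvdp_exp2l.
  move=> dvdW jd; have : W = 0.
    apply: contraTeq dvdW => Wn0; apply/negP => /(dvdp_leq Wn0).
    rewrite size_exp_XsubC leqNgt => /negP; apply.
    by rewrite ltnS; apply: leq_trans (size_poly _ _) _.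
  by move=> /polyP/(_ j); rewrite coef_poly jd coef0.
move=> j a b jd.
have : B (a + b)%N j = 0 by apply: horner_eq0 => q; exact: W0.
move=> /polyP/(_ a); rewrite coef_poly coef0 ifT; last by rewrite ltnS leq_addr.
rewrite addKn => /eqP; rewrite -mulr_natr !mulf_eq0 expf_eq0 oppr_eq0 oner_eq0 andbF/=.
by rewrite pnatr_eq0 -leqn0 leqNgt bin_gt0 leq_addr/= orbF => /eqP.
Qed.
End Algebra.

(** * Functions on the plane with vanishing line integrals *)

Section Rays.
Context {R : realType}.
Notation mu := (@lebesgue_measure R).

Lemma Cc_shear (f : R * R -> R) (p : R) : Cc f ->
  Cc (fun z : R * R => f (z.1, z.2 + p * z.1)).
Proof.
apply: (@Cc_comp _ _ _ (fun z : R * R => (z.1, z.2 + p * z.1))).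
  move=> z.
  have c2 : (fun z => z.2 + p * z.1) @ z --> z.2 + p * z.1.
    apply: cvgD; first exact: cvg_snd.
    by apply: cvgM; [exact: cvg_cst|exact: cvg_fst].
  exact: (cvg_pair cvg_fst c2).
move=> C; exists (C + `|p| * C) => z; rewrite prod_normE/= ge_max => /andP[z1 z2].
have C0 : 0 <= C := le_trans (normr_ge0 _) z1.
rewrite prod_normE ge_max; apply/andP; split.
  by apply: le_trans z1 _; rewrite lerDl mulr_ge0.
rewrite -[z.2](addrK (p * z.1)); apply: le_trans (ler_normB _ _) _.
by rewrite lerD// normrM ler_wpM2l.
Qed.

Definition moment (f : R * R -> R) (a b : nat) : R :=
  \int[mu]_(u in setT) (\int[mu]_(v in setT) (u ^+ a * v ^+ b * f (u, v))).

Lemma Cc_moment (f : R * R -> R) (a b : nat) : Cc f ->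
  Cc (fun z : R * R => z.1 ^+ a * z.2 ^+ b * f z).
Proof.
move=> Cf; apply: CcM => // z; apply: cvgM; last exact: continuous_snd_exp.
exact: continuous_fst_exp.
Qed.

(** Integrate the hypothesis against [c^r], exchange the integrals, and
    substitute [c = v - p u] in the integral over [c]. *)
Lemma ray_moments (d : nat) (g : nat -> R * R -> R) (k r : nat) (p : R) :
  (forall j, Cc (g j)) ->
  (forall c, \int[mu]_(u in setT)
     (u ^+ k * \sum_(j < d.+1) p ^+ j * g j (u, c + p * u)) = 0) ->
  \sum_(j < d.+1) p ^+ j *
    (\sum_(i < r.+1) (- p) ^+ i * moment (g j) (k + i) (r - i) *+ 'C(r, i)) = 0.
Proof.
move=> Cg H.
pose S z : R := \sum_(j < d.+1) p ^+ j * g j z.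
have CS : Cc S by apply: Cc_sum => j _; exact: CcZ.
pose T (z : R * R) := z.2 ^+ r * (z.1 ^+ k * S (z.1, z.2 + p * z.1)).
have CT : Cc T.
  apply: CcM; first exact: continuous_snd_exp.
  by apply: CcM; [exact: continuous_fst_exp|exact: Cc_shear].
pose U (z : R * R) := (z.2 - p * z.1) ^+ r * (z.1 ^+ k * S z).
have TU u : \int[mu]_(c in setT) T (u, c) = \int[mu]_(v in setT) U (u, v).
  rewrite (@Rintegral_affine _ (fun c => T (u, c)) 1 (- (p * u)))//; last exact: Cc_sectionl.
  rewrite normr1 mul1r; apply: eq_Rintegral => v _.
  by rewrite /T /U /= mul1r subrK.
have : \int[mu]_(u in setT) \int[mu]_(v in setT) U (u, v) = 0.
  under eq_Rintegral do rewrite -TU.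
  rewrite Cc_fubini//.
  under eq_Rintegral => c _.
    rewrite /T/= RintegralZ_Cc ?H ?mulr0.
      over.
    apply: CcM; first exact: exprn_continuous.
    exact: (Cc_sectionr c (Cc_shear p CS)).
  by rewrite Rintegral_cst// mul0r.
move=> U0; rewrite -[RHS]U0.
pose V (j i : nat) (z : R * R) := z.1 ^+ (k + i) * z.2 ^+ (r - i) * g j z.
have CV j i : Cc (V j i) by exact: Cc_moment.
pose w (j i : nat) := p ^+ j * ((- p) ^+ i *+ 'C(r, i)).
have UV z : U z = \sum_(j < d.+1) \sum_(i < r.+1) w j i * V j i z.
  rewrite /U exprDn /S !mulr_sumr; apply: eq_bigr => j _.
  rewrite mulr_suml; apply: eq_bigr => i _.
  rewrite /w /V -mulNr exprMn exprD.
  by rewrite -(mulr_natr _ 'C(r, i)) -[(- p) ^+ i *+ _](mulr_natr _ 'C(r, i)); ring.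
have CW j : Cc (fun z => \sum_(i < r.+1) w j i * V j i z).
  by apply: Cc_sum => i _; exact: CcZ.
have inner u : \int[mu]_(v in setT) U (u, v) =
    \sum_(j < d.+1) \sum_(i < r.+1) w j i * \int[mu]_(v in setT) V j i (u, v).
  under eq_Rintegral do rewrite UV.
  rewrite Rintegral_sum_Cc; last by move=> j; exact: (Cc_sectionl u (CW j)).
  apply: eq_bigr => j _.
  rewrite Rintegral_sum_Cc; last by move=> i; apply: CcZ; exact: Cc_sectionl.
  by apply: eq_bigr => i _; rewrite RintegralZ_Cc//; exact: Cc_sectionl.
under [RHS]eq_Rintegral do rewrite inner.
rewrite Rintegral_sum_Cc; last first.
  by move=> j; apply: Cc_sum => i _; apply: CcZ; exact: Cc_integral_section.
apply: eq_bigr => j _; rewrite Rintegral_sum_Cc; last first.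
  by move=> i; apply: CcZ; exact: Cc_integral_section.
rewrite mulr_sumr; apply: eq_bigr => i _.
rewrite RintegralZ_Cc; last exact: Cc_integral_section.
by rewrite /w -mulrA mulrnAl.
Qed.

Lemma ray_injectivity (m d : nat) (g : nat -> R * R -> R) : (d <= m)%N ->
  (forall j, Cc (g j)) ->
  (forall k p c, (k <= m)%N -> \int[mu]_(u in setT)
     (u ^+ k * \sum_(j < d.+1) p ^+ j * g j (u, c + p * u)) = 0) ->
  forall j z, (j <= d)%N -> g j z = 0.
Proof.
move=> dm Cg H j z jd; apply: Cc_moments2_eq0 => // a b.
apply: (@diagonal_moments_eq0 _ m d (fun j => moment (g j))) => // k r p km.
by apply: ray_moments => // c; exact: H.
Qed.
End Rays.

(** * Tensors and their homogeneous polynomials *)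

(** [A] is [R] for a tensor, and a type of functions for a tensor field. *)
Definition perm_invariant (n : nat) (A : Type) (T : seq 'I_n -> A) : Prop :=
  forall I I', perm_eq I I' -> T I = T I'.

Definition homog (R : realType) (n p : nat) (T : seq 'I_n -> R) (z : 'rV[R]_n) : R :=
  \sum_(I : p.-tuple 'I_n) T I * \prod_(i <- I) z 0 i.

Section Homogeneous.
Context {R : realType} {n : nat}.
Implicit Types (T : seq 'I_n -> R) (z : 'rV[R]_n).

Lemma eq_homog p T T' z : (forall I, size I = p -> T I = T' I) ->
  homog p T z = homog p T' z.
Proof. by move=> TT'; apply: eq_bigr => I _; rewrite TT'// size_tuple. Qed.

Lemma homog0 T z : homog 0 T z = T [::].
Proof.
rewrite /homog (bigD1 [tuple])//= big_nil mulr1 big1 ?addr0// => I.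
by move=> /eqP I0; case: I0; rewrite [I]tuple0.
Qed.

Lemma homogS p T z :
  homog p.+1 T z = \sum_i z 0 i * homog p (fun I => T (i :: I)) z.
Proof.
rewrite /homog (reindex (fun iI : 'I_n * p.-tuple 'I_n => [tuple of iI.1 :: iI.2]))/=.
  rewrite -(pair_bigA _ (fun i (I : p.-tuple 'I_n) =>
    T (i :: I) * \prod_(j <- i :: I) z 0 j))/=.
  apply: eq_bigr => i _; rewrite mulr_sumr; apply: eq_bigr => I _.
  by rewrite big_cons mulrCA.
exists (fun I : p.+1.-tuple 'I_n => (thead I, [tuple of behead I])) => [[i I] _|I _].
  by congr (_, _) => //; apply: val_inj.
by rewrite /= [RHS]tuple_eta.
Qed.

Lemma homog_reindex p T z (h : p.-tuple 'I_n -> p.-tuple 'I_n) :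
  injective h -> (forall I, perm_eq (h I) I) ->
  \sum_(I : p.-tuple 'I_n) T (h I) * \prod_(i <- I) z 0 i = homog p T z.
Proof.
move=> hinj hperm; rewrite /homog [RHS](reindex_inj hinj).
by apply: eq_bigr => I _; rewrite (perm_big _ (hperm I)).
Qed.

Lemma homog_rev p T z : homog p (T \o rev) z = homog p T z.
Proof.
apply: (@homog_reindex p T z (fun I => [tuple of rev I])).
  by move=> I J /(congr1 val)/= /(can_inj revK)/val_inj.
by move=> I /=; rewrite perm_rev.
Qed.

Lemma homogZ p (a : R) T z : homog p T (a *: z) = a ^+ p * homog p T z.
Proof.
elim: p T => [|p IH] T; first by rewrite !homog0 expr0 mul1r.
rewrite !homogS mulr_sumr; apply: eq_bigr => i _.
by rewrite IH mxE exprS; ring.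
Qed.

(** The coefficient of [s^k] is the polynomial of the tensor with [k] of its
    indices set to [i], counted once for each choice of these indices.  It
    serves twice: for [homog_eq0], and to expand a tensor field along
    the lines of a plane. *)
Lemma homog_add_delta p T z (s : R) (i : 'I_n) : perm_invariant T ->
  homog p T (z + s *: delta_mx 0 i) =
  \sum_(k < p.+1) s ^+ k *
    ('C(p, k)%:R * homog (p - k) (fun I => T (nseq k i ++ I)) z).
Proof.
elim: p T => [|p IH] T symT.
  by rewrite big_ord1 !homog0 expr0 bin0 !mul1r.
pose a k := homog (p.+1 - k) (fun I => T (nseq k i ++ I)) z.
have symTl (l : 'I_n) : perm_invariant (fun I => T (l :: I)).
  by move=> I I' II'; apply: symT; rewrite perm_cons.
have -> : homog p.+1 T (z + s *: delta_mx 0 i) =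
  \sum_(k < p.+1) s ^+ k * ('C(p, k)%:R * a k) +
  \sum_(k < p.+1) s ^+ k.+1 * ('C(p, k)%:R * a k.+1).
  rewrite homogS.
  under eq_bigr do rewrite !mxE eqxx/= mulrDl.
  rewrite big_split/=; congr (_ + _).
    under eq_bigr do rewrite IH// mulr_sumr.
    rewrite exchange_big/=; apply: eq_bigr => k _.
    rewrite /a subSn; last by rewrite -ltnS.
    rewrite homogS !mulr_sumr; apply: eq_bigr => l _.
    rewrite mulrCA; congr (_ * _); rewrite mulrCA; congr (_ * (_ * _)).
    apply: eq_homog => I _; apply: symT.
    by rewrite -cat1s -[l :: I]cat1s perm_catCA.
  rewrite (bigD1 i)//= eqxx mulr1 big1 ?addr0; last first.
    by move=> l /negbTE li; rewrite li mulr0 mul0r.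
  rewrite IH// mulr_sumr; apply: eq_bigr => k _.
  by rewrite exprS mulrA.
rewrite [RHS]big_ord_recl/= bin0.
under [in RHS]eq_bigr do rewrite /bump/= add1n binS natrD mulrDl mulrDr.
rewrite [in RHS]big_split/= addrA; congr (_ + _).
rewrite -[X in X + _](_ : s ^+ 0 * ('C(p, 0)%:R * a 0) = _); last by rewrite bin0.
rewrite -(big_ord_recl p.+1 (fun k : 'I_p.+2 => s ^+ k * ('C(p, k)%:R * a k))).
by rewrite [RHS]big_ord_recr/= bin_small// mulr0n mul0r mulr0 addr0.
Qed.

(** The coefficient of [s] in [T[z + s e_i]] is a multiple of the polynomial of
    the tensor of lower rank obtained by setting one index to [i], so induction on
    the rank applies. *)
Lemma homog_eq0 p T : perm_invariant T -> (forall z, homog p T z = 0) ->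
  forall I, size I = p -> T I = 0.
Proof.
elim: p T => [|p IH] T symT T0 I.
  by move=> /size0nil ->; rewrite -(homog0 T 0).
case: I => // i I [sI]; apply: (IH (fun I => T (i :: I))) => // [J J' JJ'|z].
  by apply: symT; rewrite perm_cons.
have coef0 := @coef_sum_exp_eq0 _ p.+2
  (fun k => 'C(p.+1, k)%:R * homog (p.+1 - k) (fun I => T (nseq k i ++ I)) z).
have := coef0 _ 1%N isT; rewrite bin1 subn1/= => H.
have /eqP : p.+1%:R * homog p (fun I => T (i :: I)) z = 0.
  apply: H => s; rewrite -[RHS](T0 (z + s *: delta_mx 0 i)) homog_add_delta//.
  by apply: eq_bigr => k _; rewrite mulrC.
by rewrite mulf_eq0 pnatr_eq0 => /eqP.
Qed.

End Homogeneous.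

Section InsertDelta.
Context {R : realType} {n : nat}.
Implicit Types (f : tensor_field R n) (x : 'rV[R]_n).

Definition permute_tuple p (s : 'S_p) (I : p.-tuple 'I_n) : p.-tuple 'I_n :=
  [tuple tnth I (s j) | j < p].

Lemma symmetrizeE f p (I : p.-tuple 'I_n) x :
  symmetrize f I x = (p`!%:R)^-1 * \sum_(s : 'S_p) f (permute_tuple s I) x.
Proof.
case: I => I sz; have szE : size I = p by exact/eqP.
subst p; rewrite /symmetrize /=.
congr (_ * _); apply: eq_bigr => s _; congr (f _ x).
apply: eq_map => j; congr (tnth _ _); exact: val_inj.
Qed.

Lemma permute_tuple_inj p (s : 'S_p) : injective (permute_tuple s).
Proof.
move=> I J IJ; apply: eq_from_tnth => j.
have := congr1 (fun K => tnth K (s^-1%g j)) IJ.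
by rewrite !tnth_mktuple permKV.
Qed.

Lemma perm_permute_tuple p (s : 'S_p) (I : p.-tuple 'I_n) :
  perm_eq (permute_tuple s I) I.
Proof. by apply/tuple_permP; exists s. Qed.

(** Permuting the indices does not change the product of the coordinates of
    [z] that they select. *)
Lemma homog_symmetrize f p x (z : 'rV[R]_n) :
  homog p (fun I => symmetrize f I x) z = homog p (fun I => f I x) z.
Proof.
rewrite /homog.
under eq_bigr => I _ do rewrite symmetrizeE -mulrA mulr_suml.
rewrite -mulr_sumr exchange_big/=.
under eq_bigr => s _ do rewrite (@homog_reindex _ _ p (fun I => f I x) z
  (permute_tuple s) (@permute_tuple_inj _ s) (perm_permute_tuple s)).
by rewrite sumr_const card_Sn -[homog _ _ _ *+ _]mulr_natl mulKf//.
Qed.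

Lemma homog_i_delta f p x (z : 'rV[R]_n) :
  homog p.+2 (fun I => i_delta f I x) z =
  (\sum_i z 0 i ^+ 2) * homog p (fun I => f I x) z.
Proof.
rewrite /i_delta homog_symmetrize -homog_rev homogS mulr_suml.
apply: eq_bigr => j _; rewrite homogS (bigD1 j)//= big1 ?addr0.
  rewrite mulrA -expr2; congr (_ * _).
  rewrite -[RHS]homog_rev; apply: eq_homog => I _ /=.
  by rewrite /tensor_delta revK eqxx mulr1.
move=> i /negbTE ij; rewrite /homog big1 ?mulr0// => I _ /=.
by rewrite /tensor_delta revK ij mulr0 mul0r.
Qed.

Lemma i_delta_sym f : perm_invariant (i_delta f).
Proof.
move=> I I' II'; apply/funext => x.
rewrite /i_delta -[I]/(val (in_tuple I)).
have := II'; rewrite perm_sym => /(@tuple_permP _ _ _ (in_tuple I))[s I'E].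
have -> : I' = permute_tuple s (in_tuple I) by rewrite I'E.
rewrite !symmetrizeE (reindex_inj (mulIg s)); congr (_ * _).
apply: eq_bigr => t _; congr (tensor_delta f _ x); congr val.
by apply: eq_from_tnth => j; rewrite !tnth_mktuple permM.
Qed.

Lemma i_deltaD f g : i_delta (f + g) = i_delta f + i_delta g.
Proof.
apply/funext => I; apply/funext => x.
have E h : i_delta h I x = i_delta h (in_tuple I) x by [].
rewrite -[RHS]/(i_delta f I x + i_delta g I x) !E /i_delta !symmetrizeE.
rewrite -mulrDr -big_split/=; congr (_ * _); apply: eq_bigr => s _.
rewrite /tensor_delta; case: (rev _) => [|j [|i K]]; rewrite ?addr0//.
by rewrite -mulrDl.
Qed.

Lemma i_delta0 : i_delta (0 : tensor_field R n) = 0.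
Proof. by apply: (@addrI _ (i_delta 0)); rewrite -i_deltaD !addr0. Qed.

Lemma i_delta_sum (K : Type) (r : seq K) (P : pred K) (F : K -> tensor_field R n) :
  i_delta (\sum_(i <- r | P i) F i) = \sum_(i <- r | P i) i_delta (F i).
Proof. by apply: big_morph; [exact: i_deltaD|exact: i_delta0]. Qed.

Lemma sum_fieldE (K : Type) (r : seq K) (P : pred K) (F : K -> tensor_field R n) J x :
  (\sum_(i <- r | P i) F i) J x = \sum_(i <- r | P i) F i J x.
Proof. by apply: (big_morph (fun f : tensor_field R n => f J x)). Qed.

(** All that the argument uses of a smooth compactly supported symmetric
    field; unlike smoothness, it is immediate that [i_delta] preserves it. *)
Definition Cc_field (p : nat) (f : tensor_field R n) : Prop :=
  [/\ forall I, size I != p -> f I = 0, perm_invariant f & forall I, Cc (f I)].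

Lemma Cc_field_sum p (K : Type) (r : seq K) (P : pred K) (F : K -> tensor_field R n) :
  (forall i, P i -> Cc_field p (F i)) -> Cc_field p (\sum_(i <- r | P i) F i).
Proof.
move=> HF; apply: big_ind => //.
  by split => // I; exact: Cc0.
move=> f g [f1 f2 f3] [g1 g2 g3]; split.
- move=> J Jp; rewrite -[LHS]/(f J + g J) f1// g1// addr0//.
- move=> J J' JJ'; rewrite -[LHS]/(f J + g J) -[RHS]/(f J' + g J').
  by rewrite (f2 _ _ JJ') (g2 _ _ JJ').
- by move=> J; exact: (CcD (f3 J) (g3 J)).
Qed.

Lemma Cc_field_i_delta p f : Cc_field p f -> Cc_field p.+2 (i_delta f).
Proof.
move=> [f1 f2 f3]; split; [|exact: i_delta_sym|].
- move=> I Ip; apply/funext => x.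
  rewrite /i_delta -[I]/(val (in_tuple I)) symmetrizeE big1 ?mulr0// => s _.
  have : size (permute_tuple s (in_tuple I)) != p.+2 by rewrite size_tuple.
  rewrite /tensor_delta -size_rev; case: (rev _) => [|j [|i K]]//= Kp.
  by rewrite f1 ?mul0r// size_rev; apply: contraNneq Kp => ->.
- move=> I.
  have -> : i_delta f I = fun x => ((size I)`!%:R)^-1 *
     \sum_(s : 'S_(size I)) tensor_delta f (permute_tuple s (in_tuple I)) x.
    by apply/funext => x; rewrite -symmetrizeE.
  apply: CcZ; apply: Cc_sum => s _.
  rewrite /tensor_delta; case: (rev _) => [|j [|i K]]; try exact: Cc0.
  have -> : (fun x => f (rev K) x * (i == j)%:R) =
            (fun x => (i == j)%:R * f (rev K) x).
    by apply/funext => x; rewrite mulrC.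
  exact: CcZ.
Qed.

Lemma Cc_field_iter p k f : Cc_field p f ->
  Cc_field (p + 2 * k) (iter k (@i_delta R n) f).
Proof.
move=> Cf; elim: k => [|k IH] /=; first by rewrite muln0 addn0.
by rewrite mulnS addnCA add2n; exact: Cc_field_i_delta.
Qed.

Lemma homog_iter p k f x (z : 'rV[R]_n) :
  homog (p + 2 * k) (fun I => iter k (@i_delta R n) f I x) z =
  (\sum_i z 0 i ^+ 2) ^+ k * homog p (fun I => f I x) z.
Proof.
elim: k => [|k IH]; first by rewrite muln0 addn0 expr0 mul1r.
by rewrite mulnS addnCA add2n /= homog_i_delta IH exprS mulrA.
Qed.

Lemma sym_field_Cc p f : sym_field p f -> Cc_field p f.
Proof.
move=> [f1 f2 f3]; split => // I; have [sf cf] := f3 I; split.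
  by have [+ _] := sf [::].
have /compact_bounded[M [_ /(_ (M + 1))]] := cf.
rewrite ltrDl ltr01 => /(_ isT) fM; exists (M + 1) => x Mx.
apply: contrapT => /eqP fx0; have := fM x.
have xs : closure [set x | f I x != 0] x by apply: subset_closure.
by move=> /(_ xs)/=; rewrite leNgt Mx.
Qed.

End InsertDelta.

(** * Moments along rays *)

Section Core.
Context {R : realType} {n : nat}.
Notation mu := (@lebesgue_measure R).
Implicit Types (F T : tensor_field R n) (x xi e z : 'rV[R]_n).

(** The sum of [a l] over the [l <= d] such that [d - l] is even; this indexing
    matches the number of times [i_delta] acts in [homogenized]. *)
Definition same_parity_sum (V : zmodType) (d : nat) (a : nat -> V) : V :=
  \sum_(0 <= j < d./2.+1) a (d - 2 * j)%N.

Lemma same_parity_sumSS (V : zmodType) d (a : nat -> V) :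
  same_parity_sum d.+2 a = a d.+2 + same_parity_sum d a.
Proof.
rewrite /same_parity_sum big_nat_recl//= muln0 subn0; congr (_ + _).
by apply: eq_big_nat => j _; rewrite mulnS subnDA subn2.
Qed.

Lemma sum_parity (V : zmodType) m (a : nat -> V) :
  \sum_(0 <= l < m.+2) a l = same_parity_sum m.+1 a + same_parity_sum m a.
Proof.
elim: m => [|m IH].
  by rewrite /same_parity_sum !big_nat_recr//= !big_nil !add0r addrC.
rewrite big_nat_recr//= IH same_parity_sumSS -addrA addrC; congr (_ + _).
exact: addrC.
Qed.

Lemma same_parity_sum_sign d (a : nat -> R) :
  same_parity_sum d (fun l => (-1) ^+ l * a l) = (-1) ^+ d * same_parity_sum d a.
Proof.
rewrite /same_parity_sum mulr_sumr; apply: eq_big_nat => j /andP[_ jd].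
congr (_ * _); have jd2 : (2 * j <= d)%N by lia.
by rewrite -signr_odd oddB// mul2n odd_double addbF signr_odd.
Qed.

Definition ray_moment (l k : nat) F x xi : R :=
  \int[mu]_(t in setT) (t ^+ k * homog l (fun I => part l F I (x + t *: xi)) xi).

Lemma moment_rayE m k F x xi :
  moment_ray m k F x xi = \sum_(0 <= l < m.+1) ray_moment l k F x xi.
Proof. by []. Qed.

Definition homogenized (d : nat) F : tensor_field R n :=
  \sum_(0 <= j < d./2.+1) iter j (@i_delta R n) (part (d - 2 * j) F).

Lemma homog_homogenized d F x z :
  homog d (fun I => homogenized d F I x) z =
  \sum_(0 <= j < d./2.+1) (\sum_i z 0 i ^+ 2) ^+ j *
     homog (d - 2 * j) (fun I => part (d - 2 * j) F I x) z.
Proof.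
rewrite {1}/homog; under eq_bigr do rewrite /homogenized sum_fieldE mulr_suml.
rewrite exchange_big/=; apply: eq_big_nat => j /andP[_ jd].
rewrite -homog_iter subnK//; lia.
Qed.

Lemma Cc_homogenized m d F : (d <= m)%N -> graded_field m F ->
  Cc_field d (homogenized d F).
Proof.
move=> dm [HF _]; rewrite /homogenized big_nat; apply: Cc_field_sum => j /andP[_ jd].
have Fj : sym_field (d - 2 * j) (part (d - 2 * j) F) by apply: HF; lia.
by have := Cc_field_iter j (sym_field_Cc Fj); rewrite subnK//; lia.
Qed.

Lemma Cc_homog (V : normedModType R) p (T : seq 'I_n -> V -> R) z :
  (forall I, Cc (T I)) -> Cc (fun v => homog p (fun I => T I v) z).
Proof.
move=> CT; apply: Cc_sum => I _.
have -> : (fun v => T I v * \prod_(i <- I) z 0 i) =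
          (fun v => \prod_(i <- I) z 0 i * T I v).
  by apply/funext => v; rewrite mulrC.
exact: CcZ.
Qed.

Lemma Cc_line (f : 'rV[R]_n -> R) x xi : xi != 0 -> Cc f ->
  Cc (fun t : R => f (x + t *: xi)).
Proof.
move=> xi0; apply: (@Cc_comp _ _ _ (fun t : R => x + t *: xi)).
  move=> t; apply: cvgD; first exact: cvg_cst.
  by apply: cvgZ; [exact: cvg_id|exact: cvg_cst].
move=> C; exists ((C + `|x|) / `|xi|) => t tC.
rewrite ler_pdivlMr ?normr_gt0// -normrZ.
rewrite -[t *: xi](addKr x) addrC; apply: le_trans (ler_normD _ _) _.
by rewrite normrN lerD2r.
Qed.

Lemma coord_le_norm x (i : 'I_n) : `|x 0 i| <= `|x|.
Proof.
rewrite [leRHS]/Num.norm/= mx_normrE.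
by apply: (le_bigmax _ (fun ij => `|x ij.1 ij.2|) (ord0, i)).
Qed.

(** The hypotheses make [e] and the [j]-th basis vector independent: coordinate
    [i] of the point bounds [z.1], and then coordinate [j] bounds [z.2]. *)
Lemma Cc_plane (f : 'rV[R]_n -> R) x e (i j : 'I_n) : e 0 i != 0 -> i != j ->
  Cc f -> Cc (fun z : R * R => f (x + z.1 *: e + z.2 *: delta_mx 0 j)).
Proof.
move=> ei ij; apply: (@Cc_comp _ _ _
  (fun z : R * R => x + z.1 *: e + z.2 *: delta_mx 0 j)).
  move=> z; apply: cvgD.
    apply: cvgD; first exact: cvg_cst.
    by apply: cvgZ; [exact: cvg_fst|exact: cvg_cst].
  by apply: cvgZ; [exact: cvg_snd|exact: cvg_cst].
move=> C; pose A := (C + `|x 0 i|) / `|e 0 i|.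
exists (Num.max A (C + `|x 0 j| + A * `|e 0 j|)) => z zC.
have zA : `|z.1| <= A.
  rewrite ler_pdivlMr ?normr_gt0// -normrM.
  have := le_trans (coord_le_norm _ i) zC; rewrite !mxE eqxx (negbTE ij) mulr0 addr0.
  move=> zi; rewrite -[z.1 * _](addKr (x 0 i)) addrC; apply: le_trans (ler_normD _ _) _.
  by rewrite normrN lerD2r.
rewrite prod_normE ge_max !le_max zA/=; apply/orP; right.
have := le_trans (coord_le_norm _ j) zC; rewrite !mxE !eqxx mulr1 => zj.
rewrite -[z.2](addKr (x 0 j + z.1 * e 0 j)) addrC; apply: le_trans (ler_normD _ _) _.
rewrite normrN -[leRHS]addrA lerD//; apply: le_trans (ler_normD _ _) _.
by rewrite lerD2l normrM ler_wpM2r.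
Qed.

Lemma exists_coord_neq0 z : z != 0 -> exists i, z 0 i != 0.
Proof.
move=> z0; apply: contrapT => H; move/eqP: z0; apply.
apply/rowP => i; rewrite mxE; apply: contrapT => zi; apply: H.
by exists i; exact/eqP.
Qed.

Lemma unit_sphere_neq0 xi : unit_sphere xi -> xi != 0.
Proof.
move=> xi1; apply/eqP => xi0; have := xi1; rewrite xi0 /unit_sphere big1.
  by move/esym/eqP; rewrite oner_eq0.
by move=> i _; rewrite mxE expr0n.
Qed.

(** With [a = |z|] and [xi = z / a], substitute [a t] for [t] in the integral
    along [xi]; the homogeneity of degree [d] takes care of the other argument. *)
Lemma homog_ray_rescale d T k x z :
  Cc_field d T -> z != 0 ->
  (forall xi, unit_sphere xi -> \int[mu]_(t in setT)
    (t ^+ k * homog d (fun I => T I (x + t *: xi)) xi) = 0) ->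
  \int[mu]_(t in setT) (t ^+ k * homog d (fun I => T I (x + t *: z)) z) = 0.
Proof.
move=> [T1 T2 T3] z0 H.
have CT y : y != 0 ->
    Cc (fun t : R => t ^+ k * homog d (fun I => T I (x + t *: y)) y).
  move=> y0; apply: CcM; first exact: exprn_continuous.
  by apply: Cc_homog => I; exact: Cc_line.
have [i zi] := exists_coord_neq0 z0.
pose s := \sum_i z 0 i ^+ 2.
have s0 : 0 < s.
  rewrite /s (bigD1 i)//= ltr_pwDl ?exprn_even_gt0//.
  by apply: sumr_ge0 => j _; exact: sqr_ge0.
pose a := Num.sqrt s.
have a0 : 0 < a by rewrite sqrtr_gt0.
have aN0 := lt0r_neq0 a0.
pose xi := a^-1 *: z.
have xi1 : unit_sphere xi.
  rewrite /unit_sphere; under eq_bigr do rewrite mxE exprMn.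
  by rewrite -mulr_sumr -/s exprVn sqr_sqrtr ?ltW// mulVf// lt0r_neq0.
have xi0 : xi != 0 by rewrite scaler_eq0 invr_eq0 negb_or aN0.
have zE : z = a *: xi by rewrite scalerA mulfV// scale1r.
have := H xi xi1; rewrite (Rintegral_affine 0 aN0 (CT _ xi0)).
move/eqP; rewrite mulf_eq0 normr_eq0 (negbTE aN0)/= => /eqP H0.
have -> : (fun t => t ^+ k * homog d (fun I => T I (x + t *: z)) z) =
   fun t => (a ^+ d * a ^- k) * ((a * t + 0) ^+ k *
      homog d (fun I => T I (x + (a * t + 0) *: xi)) xi).
  apply/funext => t; rewrite addr0 {2}zE homogZ exprMn.
  have -> : (a * t) *: xi = t *: z by rewrite mulrC -scalerA -zE.
  by rewrite -!mulrA mulrCA; congr (_ * _); rewrite mulKf ?expf_neq0.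
by rewrite RintegralZ_Cc ?H0 ?mulr0//; exact: (Cc_affine 0 aN0 (CT _ xi0)).
Qed.

(** The field is restricted to the plane through [x] spanned by [z] and a basis
    vector [e_j] chosen independent of [z], which [n >= 2] allows.  The functions [g k] are
    the coefficients of [p^k] in [T[z + p e_j]] there. *)
Lemma homog_rays_eq0 m d T : (2 <= n)%N -> (d <= m)%N -> Cc_field d T ->
  (forall k x xi, (k <= m)%N -> unit_sphere xi -> \int[mu]_(t in setT)
    (t ^+ k * homog d (fun I => T I (x + t *: xi)) xi) = 0) ->
  T = 0.
Proof.
move=> n2 dm CT H; have [T1 T2 T3] := CT.
have nonzero x z : z != 0 -> homog d (fun I => T I x) z = 0.
  move=> z0; have [i zi] := exists_coord_neq0 z0.
  have [j ij] : exists j, i != j.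
    pose a : 'I_n := Ordinal (ltnW n2); pose b : 'I_n := Ordinal n2.
    by have [->|] := eqVneq i a; [exists b|exists a].
  pose g k (w : R * R) : R := 'C(d, k)%:R * homog (d - k)
    (fun I => T (nseq k j ++ I) (x + w.1 *: z + w.2 *: delta_mx 0 j)) z.
  have Cg k : Cc (g k).
    by apply: CcZ; apply: Cc_homog => I; exact: (Cc_plane x zi ij).
  (* At the origin of the plane, [g 0] is the value that is sought. *)
  have g0 : g 0%N (0, 0) = 0.
    apply: (ray_injectivity dm Cg) => // k p c km.
    pose e := z + p *: delta_mx 0 j.
    have e0 : e != 0.
      apply: contraNneq zi => /rowP/(_ i); rewrite !mxE eqxx (negbTE ij) mulr0 addr0.
      by move=> ->.
    rewrite -[RHS](@homog_ray_rescale d T k (x + c *: delta_mx 0 j) e CT e0); last first.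
      by move=> xi; exact: H.
    apply: eq_Rintegral => u _; congr (_ * _).
    rewrite homog_add_delta; last by move=> I J IJ; rewrite (T2 _ _ IJ).
    apply: eq_bigr => l _; congr (_ * (_ * _)); apply: eq_homog => I _ /=.
    congr (T _ _); rewrite /e scalerDr scalerDl scalerA [u * p]mulrC.
    by rewrite -!addrA; congr (_ + _); rewrite addrCA.
  by move: g0; rewrite /g bin0 mul1r subn0/= !scale0r !addr0.
apply/funext => I; apply/funext => x.
have [Id|Id] := eqVneq (size I) d; last by rewrite T1.
apply: (@homog_eq0 _ _ d (fun I => T I x)) => // [J J' JJ'|z].
  by rewrite (T2 _ _ JJ').
(* For [z = 0] the polynomial is zero, or constant if [d = 0]. *)
have [->|/nonzero//] := eqVneq z 0.
case: d {dm CT T1 H Id} nonzero => [|d] nonzero; last first.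
  by rewrite homogS big1// => i _; rewrite mxE mul0r.
rewrite homog0 -(homog0 (fun I => T I x) (delta_mx 0 (Ordinal n2))).
apply: nonzero; apply/eqP => /rowP/(_ (Ordinal n2))/eqP.
by rewrite !mxE !eqxx oner_eq0.
Qed.

(** On the unit sphere the powers of [|xi|^2] produced by [i_delta] are
    equal to one. *)
Lemma integral_homogenized m d F k x xi : (d <= m)%N -> graded_field m F ->
  unit_sphere xi ->
  \int[mu]_(t in setT) (t ^+ k * homog d (fun I => homogenized d F I (x + t *: xi)) xi)
  = same_parity_sum d (fun l => ray_moment l k F x xi).
Proof.
move=> dm [HF _] xi1.
have xi0 := unit_sphere_neq0 xi1.
have CF l : Cc (fun t : R => t ^+ k * (if (l <= d)%N then
    homog l (fun I => part l F I (x + t *: xi)) xi else 0)).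
  apply: CcM; first exact: exprn_continuous.
  case: (boolP (l <= d)%N) => ld; last exact: Cc0.
  have [_ _ F3] := sym_field_Cc (HF l (leq_trans ld dm)).
  by apply: Cc_homog => I; exact: Cc_line.
transitivity (\int[mu]_(t in setT) \sum_(0 <= j < d./2.+1)
   (t ^+ k * (if (d - 2 * j <= d)%N then
    homog (d - 2 * j) (fun I => part (d - 2 * j) F I (x + t *: xi)) xi else 0))).
  apply: eq_Rintegral => t _; rewrite homog_homogenized xi1 mulr_sumr.
  by apply: eq_bigr => j _; rewrite expr1n mul1r leq_subr.
rewrite Rintegral_sum_Cc; last by move=> j; exact: CF.
by apply: eq_bigr => j _; apply: eq_Rintegral => t _; rewrite leq_subr.
Qed.

Lemma same_parity_rays_eq0 m d F : (2 <= n)%N -> (d <= m)%N -> graded_field m F ->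
  (forall k x xi, (k <= m)%N -> unit_sphere xi ->
     same_parity_sum d (fun l => ray_moment l k F x xi) = 0) <->
  homogenized d F = 0.
Proof.
move=> n2 dm HF; split=> [H|H k x xi km xi1].
  apply: (homog_rays_eq0 n2 dm (Cc_homogenized dm HF)) => k x xi km xi1.
  by rewrite (integral_homogenized _ _ dm)// H.
rewrite -(integral_homogenized k x dm HF xi1) H.
under eq_Rintegral.
  move=> t _; rewrite /homog big1 ?mulr0; last by move=> I _; rewrite mul0r.
  over.
by rewrite Rintegral_cst// mul0r.
Qed.

Lemma ray_momentN l k F x xi : sym_field l (part l F) -> xi != 0 ->
  ray_moment l k F x (- xi) = (-1) ^+ (k + l) * ray_moment l k F x xi.
Proof.
move=> Fl xi0; have [_ _ F3] := sym_field_Cc Fl.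
rewrite /ray_moment.
have CF y : y != 0 ->
    Cc (fun t : R => t ^+ k * homog l (fun I => part l F I (x + t *: y)) y).
  move=> y0; apply: CcM; first exact: exprn_continuous.
  by apply: Cc_homog => I; exact: Cc_line.
have N1 : -1 != 0 :> R by rewrite oppr_eq0 oner_eq0.
have xiN0 : - xi != 0 by rewrite oppr_eq0.
rewrite (Rintegral_affine 0 N1 (CF _ xiN0)) normrN1 mul1r -RintegralZ_Cc; last exact: CF.
apply: eq_Rintegral => t _; rewrite addr0 mulN1r scalerN scaleNr opprK.
rewrite -(scaleN1r xi) homogZ (exprNn t) exprD.
by rewrite mulrACA.
Qed.

Lemma unit_sphereN xi : unit_sphere xi -> unit_sphere (- xi).
Proof. by rewrite /unit_sphere; under [in X in _ -> X]eq_bigr do rewrite mxE sqrrN. Qed.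

(** The rays along [xi] and [-xi] give the sum and, up to sign, the difference
    of the two parity classes. *)
Lemma moment_ray_parity m k F x xi : graded_field m.+1 F -> unit_sphere xi ->
  moment_ray m.+1 k F x xi = 0 -> moment_ray m.+1 k F x (- xi) = 0 ->
  same_parity_sum m.+1 (fun l => ray_moment l k F x xi) = 0 /\
  same_parity_sum m (fun l => ray_moment l k F x xi) = 0.
Proof.
move=> [HF _] xi1; rewrite !moment_rayE; pose a l := ray_moment l k F x xi.
have -> : \sum_(0 <= l < m.+2) ray_moment l k F x (- xi) =
    (-1) ^+ k * \sum_(0 <= l < m.+2) (-1) ^+ l * a l.
  rewrite mulr_sumr; apply: eq_big_nat => l /andP[_ lm].
  by rewrite ray_momentN ?unit_sphere_neq0 ?exprD ?mulrA//; exact: HF.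
rewrite -[\sum_(0 <= l < m.+2) ray_moment l k F x xi]/(\sum_(0 <= l < m.+2) a l).
rewrite !sum_parity !same_parity_sum_sign exprS mulN1r mulNr => e1 /eqP.
rewrite addrC -mulrBr !mulf_eq0 !signr_eq0/= => /eqP e2.
rewrite -/(same_parity_sum m.+1 a) -/(same_parity_sum m a).
by split; lra.
Qed.

(** The term [j = 0] of [homogenized d F] is [part d F]; the others have a factor
    [i_delta], and [l = M + 1 - j]. *)
Lemma homogenized_eq0 (d M : nat) F : d./2 = M ->
  homogenized d F = 0 <->
  part d F = - i_delta (\sum_(1 <= l < M.+1)
    iter (M - l) (@i_delta R n) (part (d - 2 * (M.+1 - l)) F)).
Proof.
move=> dM; rewrite /homogenized dM big_nat_recl//= muln0 subn0.
have -> : \sum_(0 <= j < M) i_delta (iter j (@i_delta R n) (part (d - 2 * j.+1) F)) =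
  i_delta (\sum_(1 <= l < M.+1)
    iter (M - l) (@i_delta R n) (part (d - 2 * (M.+1 - l)) F)).
  rewrite i_delta_sum big_add1 big_nat_rev/=; apply: eq_big_nat => j /andP[_ jM].
  by congr (i_delta (iter _ _ (part _ _))); lia.
by split=> [/eqP|->]; [rewrite addr_eq0 => /eqP|rewrite addNr].
Qed.

Lemma homogenized0 F : homogenized 0 F = part 0 F.
Proof. by rewrite /homogenized big_nat1. Qed.

Lemma homogenized1 F : homogenized 1 F = part 1 F.
Proof. by rewrite /homogenized big_nat1. Qed.

Lemma moment_ray_eq0 m F : (2 <= n)%N -> graded_field m.+1 F ->
  (forall k x xi, (k <= m.+1)%N -> unit_sphere xi ->
     moment_ray m.+1 k F x xi = 0) <->
  homogenized m.+1 F = 0 /\ homogenized m F = 0.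
Proof.
move=> n2 HF.
have P1 := same_parity_rays_eq0 n2 (leqnn m.+1) HF.
have P0 := same_parity_rays_eq0 n2 (leqnSn m) HF.
split=> [H|[/P1 H1 /P0 H0] k x xi km xi1]; last first.
  by rewrite moment_rayE sum_parity H1// H0// addr0.
have H2 k x xi (km : (k <= m.+1)%N) (xi1 : unit_sphere xi) :=
  moment_ray_parity HF xi1 (H k x xi km xi1) (H k x (- xi) km (unit_sphereN xi1)).
by split; [apply/P1|apply/P0] => k x xi km xi1; have [] := H2 k x xi km xi1.
Qed.

End Core.

Theorem theorem4p18 (R : realType) (n : nat) (n_ge2 : (2 <= n)%N) :
  (forall (m : nat) (F : tensor_field R n),
     (2 <= m)%N -> graded_field m F ->
     ((forall (k : nat) (x xi : 'rV[R]_n), (k <= m)%N ->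
          unit_sphere xi -> moment_ray m k F x xi = 0)
      <->
      (part (2 * (m %/ 2))%N F =
         - i_delta (\sum_(1 <= l < (m %/ 2).+1%N)
             iter (m %/ 2 - l)%N (@i_delta R n) (part (2 * l - 2)%N F))
       /\
       part (2 * ((m - 1) %/ 2) + 1)%N F =
         - i_delta (\sum_(1 <= l < ((m - 1) %/ 2).+1%N)
             iter ((m - 1) %/ 2 - l)%N (@i_delta R n) (part (2 * l - 1)%N F)))))
  /\
  (forall (m : nat) (F : tensor_field R n),
     (m <= 1)%N -> graded_field m F ->
     ((forall (k : nat) (x xi : 'rV[R]_n), (k <= m)%N ->
          unit_sphere xi -> moment_ray m k F x xi = 0)
      <-> F = 0)).
Proof.
split=> m F.
  case: m => [//|m] _ HF; rewrite (moment_ray_eq0 n_ge2 HF).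
  set M := (m.+1 %/ 2)%N; set L := ((m.+1 - 1) %/ 2)%N.
  have HM : homogenized (2 * M) F = 0 <-> part (2 * M) F = - i_delta
      (\sum_(1 <= l < M.+1) iter (M - l) (@i_delta R n) (part (2 * l - 2) F)).
    rewrite (@homogenized_eq0 _ _ (2 * M) M); last by rewrite mul2n doubleK.
    rewrite (eq_big_nat _ _ (F2 := fun l =>
      iter (M - l) (@i_delta R n) (part (2 * l - 2) F)))// => l /andP[l1 lM].
    by congr (iter _ _ (part _ _)); lia.
  have HL : homogenized (2 * L + 1) F = 0 <-> part (2 * L + 1) F = - i_delta
      (\sum_(1 <= l < L.+1) iter (L - l) (@i_delta R n) (part (2 * l - 1) F)).
    rewrite (@homogenized_eq0 _ _ (2 * L + 1) L); last by lia.
    rewrite (eq_big_nat _ _ (F2 := fun l =>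
      iter (L - l) (@i_delta R n) (part (2 * l - 1) F)))// => l /andP[l1 lM].
    by congr (iter _ _ (part _ _)); lia.
  rewrite -HM -HL.
  have [[-> ->]|[-> ->]] : (2 * M = m.+1 /\ 2 * L + 1 = m \/
      2 * M = m /\ 2 * L + 1 = m.+1)%N by rewrite /M /L; lia.
    by [].
  by split=> [[]|[]].
move=> m1 HF; have [_ FE] := HF.
case: m m1 HF FE => [|[|//]] _ HF FE.
  have {}FE : F = part 0 F by rewrite {1}FE big_nat1.
  rewrite {2}FE -homogenized0 -(same_parity_rays_eq0 n_ge2 (leqnn 0) HF).
  by split=> H k x xi km xi1; have := H k x xi km xi1;
    rewrite moment_rayE /same_parity_sum !big_nat1.
rewrite (moment_ray_eq0 n_ge2 HF) homogenized0 homogenized1; split=> [[F1 F0]|F0].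
  by rewrite FE !big_nat_recl// big_nil/= F1 F0 !addr0.
have part0 l : part l F = 0.
  by apply/funext => I; rewrite /part F0; case: ifP.
by rewrite !part0.
Qed.
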